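(* The quadratic form $$\sum_{\sigma\in S_0}\sigma\left(x_{1,\sigma}^2+x_{2,\sigma}^2+x_{3,\sigma}^2+x_{4,\sigma}^2+\epsilon x_{5,\sigma}^2+\epsilon x_{6,\sigma}^2+\epsilon x_{7,\sigma}^2+\epsilon x_{8,\sigma}^2\right)$$ is universal over $\mathcal{O}_K$ (it represents every totally positive element of $\mathcal{O}_K$ with variables in $\mathcal{O}_K$) and has $8M_D$ variables.
   Context: $D>1$ squarefree, $K=\mathbb{Q}(\sqrt D)$, $\mathcal{O}_K$ its ring of integers, $\alpha'$ the conjugate; totally positive means $\alpha>0,\alpha'>0$. $\omega_D=\sqrt D$ if $D\equiv2,3\pmod4$, $\omega_D=\frac{1+\sqrt D}2$ if $D\equiv1\pmod4$, with continued fraction $\omega_D=[u_0;\overline{u_1,\dots,u_s}]$, $s$ minimal period. Let $p_{-1}=1,q_{-1}=0,p_0=u_0,q_0=1$, $p_{i+1}=u_{i+1}p_i+p_{i-1}$, $q_{i+1}=u_{i+1}q_i+q_{i-1}$, $\alpha_i=p_i-q_i\omega_D'$, $\alpha_{i,r}=\alpha_i+r\alpha_{i+1}$. $S=\{\alpha_{i,r},\alpha_{i,r}'\mid i\geq-1\text{ odd},0\leq r<u_{i+2}\}$, $\epsilon$ the totally positive fundamental unit of $\mathcal{O}_K$, $S_0=\{\sigma\in S\mid\epsilon>\sigma\geq\sigma'>0\}$. $M_D=u_1+u_3+\dots+u_{s-1}$ if $s$ is even; $M_D=2u_0+u_1+\dots+u_{s-1}$ if $s$ odd and $D\equiv2,3\pmod4$;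 $M_D=2u_0+u_1+\dots+u_{s-1}-1$ if $s$ odd and $D\equiv1\pmod4$. *)

(* Defs.v *)
From HB Require Import structures.
From mathcomp Require Import all_boot all_order all_algebra.
From mathcomp Require Import reals.
Set Implicit Arguments. Unset Strict Implicit. Unset Printing Implicit Defensive.
Import Order.TTheory GRing.Theory Num.Theory.
Local Open Scope ring_scope.

(* Elements of K = Q(sqrt D) are represented by pairs (a, b) of rationals,
   standing for a + b sqrt D.  The real embedding is [emb] (sqrt D > 0) and
   the Galois conjugate is [conjK] : a + b sqrt D |-> a - b sqrt D. *)
Definition Kel := (rat * rat)%type.

Definition squarefree (D : nat) : Prop :=
  forall p : nat, prime p -> ~~ (p * p %| D)%N.

Section Quad.
Variable (R : realType) (D : nat).

Definition sqrtD : R := Num.sqrt (D%:R).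
Definition emb (x : Kel) : R := ratr x.1 + ratr x.2 * sqrtD.
Definition conjK (x : Kel) : Kel := (x.1, - x.2).
Definition addK (x y : Kel) : Kel := (x.1 + y.1, x.2 + y.2).
Definition mulK (x y : Kel) : Kel :=
  (x.1 * y.1 + D%:R * x.2 * y.2, x.1 * y.2 + x.2 * y.1).
Definition intK (z : int) : Kel := (z%:~R, 0).
Definition oneK : Kel := (1, 0).

Definition totpos (x : Kel) : Prop := 0 < emb x /\ 0 < emb (conjK x).

Definition inOK (x : Kel) : Prop :=
  exists p : {poly int}, p \is monic /\ root (map_poly intr p) (emb x).

Definition unitOK (x : Kel) : Prop :=
  inOK x /\ exists y : Kel, inOK y /\ mulK x y = oneK.

Definition tp_fund_unit (e : Kel) : Prop :=
  unitOK e /\ totpos e /\ 1 < emb e /\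
  forall n : Kel, unitOK n -> totpos n -> 1 < emb n -> emb e <= emb n.

Definition omegaD : Kel :=
  if (D %% 4 == 1)%N then (1/2, 1/2) else (0, 1).

Fixpoint cf_xi (n : nat) : R :=
  match n with
  | 0 => emb omegaD
  | m.+1 => (cf_xi m - (Num.floor (cf_xi m))%:~R)^-1
  end.
Definition cf_u (n : nat) : nat := `|Num.floor (cf_xi n)|%N.

Definition min_period (s : nat) : Prop :=
  (0 < s)%N /\ (forall i, (1 <= i)%N -> cf_u (i + s) = cf_u i) /\
  forall t, (0 < t < s)%N -> exists i, (1 <= i)%N /\ cf_u (i + t) <> cf_u i.

(* convergent numerators/denominators, shifted by one:
   pq j = (p_{j-1}, q_{j-1}); p_{-1}=1, q_{-1}=0, p_0=u_0, q_0=1 *)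
Fixpoint pq (j : nat) : int * int :=
  match j with
  | 0 => (1, 0)
  | 1 => ((cf_u 0)%:Z, 1)
  | (m.+1 as k).+1 =>
      ((cf_u k)%:Z * (pq k).1 + (pq m).1, (cf_u k)%:Z * (pq k).2 + (pq m).2)
  end.

(* alpha_{j-1} = p_{j-1} - q_{j-1} omega_D' *)
Definition alpha (j : nat) : Kel :=
  addK (intK (pq j).1) (mulK (intK (- (pq j).2)) (conjK omegaD)).
Definition alphar (j r : nat) : Kel :=
  addK (alpha j) (mulK (intK r%:Z) (alpha j.+1)).

(* sigma in S : sigma = alpha_{i,r} or alpha_{i,r}' with i >= -1 odd and
   0 <= r < u_{i+2}.  Here j = i + 1 (so j >= 0 even) and u_{i+2} = u_{j+1}. *)
Definition inS (x : Kel) : Prop :=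
  exists j r : nat, ~~ odd j /\ (r < cf_u j.+1)%N /\
    (x = alphar j r \/ x = conjK (alphar j r)).

Definition inS0 (e x : Kel) : Prop :=
  inS x /\ emb x < emb e /\ emb (conjK x) <= emb x /\ 0 < emb (conjK x).

Definition M_D (s : nat) : nat :=
  if ~~ odd s then (\sum_(0 <= k < s./2) cf_u (2 * k).+1)%N
  else if (D %% 4 == 1)%N then
    (2 * cf_u 0 + \sum_(1 <= i < s) cf_u i).-1%N
  else (2 * cf_u 0 + \sum_(1 <= i < s) cf_u i)%N.

(* the quadratic form
   sum_{sigma in S_0} sigma (x1^2 + x2^2 + x3^2 + x4^2
                              + e x5^2 + e x6^2 + e x7^2 + e x8^2),
   S_0 enumerated (without repetition) by the list L, evaluated in R *)
Definition qform (e : Kel) (L : seq Kel) (x : Kel -> nat -> Kel) : R :=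
  \sum_(sg <- L) emb sg *
    (emb (x sg 0%N) ^+ 2 + emb (x sg 1%N) ^+ 2 + emb (x sg 2%N) ^+ 2
       + emb (x sg 3%N) ^+ 2
     + emb e * emb (x sg 4%N) ^+ 2 + emb e * emb (x sg 5%N) ^+ 2
     + emb e * emb (x sg 6%N) ^+ 2 + emb e * emb (x sg 7%N) ^+ 2).

Definition universal_form (e : Kel) (L : seq Kel) : Prop :=
  forall a : Kel, inOK a -> totpos a ->
    exists x : Kel -> nat -> Kel,
      (forall sg i, inOK (x sg i)) /\ emb a = qform e L x.

End Quad.

(* Main.v *)
Require Import Defs.
From HB Require Import structures.
From mathcomp Require Import all_boot all_order all_algebra all_field.
From mathcomp Require Import reals.
From mathcomp Require Import zify ring lra.
Set Implicit Arguments. Unset Strict Implicit. Unset Printing Implicit Defensive.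
Import Order.TTheory GRing.Theory Num.Theory.
Local Open Scope ring_scope.

(** The elements alpha_{i,r} (i odd) are the successive vertices of the convex
    hull of the totally positive integers below the diagonal, and two
    consecutive ones span a unimodular cone.  After multiplication by a large
    even power of epsilon, a totally positive integer lies in one of these cones,
    so it is e sigma + f tau with e, f natural numbers and sigma, tau
    consecutive.  Periodicity of the continued fraction says that multiplication
    by epsilon permutes the alpha_{i,r}, shifting i by one (even) period; hence
    sigma and tau are powers of epsilon times elements of S_0, and each of e, f
    is a sum of four squares.  For the count, epsilon is alpha_{t-1} with t = s
    or 2s: a totally positive unit has norm 1, whereas the norm is > 1 at every
    alpha_{i,r} with 0 < r < u_{i+2}, and a unit alpha_i produces a period. *)

(** * Sums of four squares *)

Definition sum4sq (n : int) : Prop :=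
  exists a b c d : int, n = a ^+ 2 + b ^+ 2 + c ^+ 2 + d ^+ 2.

(** Euler's identity, the multiplicativity of the quaternion norm: the witnesses are the coordinates
    of the second quaternion times the conjugate of the first. *)
Lemma sum4sqM m n : sum4sq m -> sum4sq n -> sum4sq (m * n).
Proof.
move=> [a [b [c [d ->]]]] [e [f [g [h ->]]]].
exists (a * e + b * f + c * g + d * h), (a * f - b * e + c * h - d * g),
  (a * g - c * e + d * f - b * h), (a * h - d * e + b * g - c * f).
by ring.
Qed.

(** Pigeonhole: a^2 and -1 - b^2 with a, b at most (p - 1) / 2 give p + 1 residues modulo p, and by
    [sq_inj] two of the same family never coincide. *)
Lemma prime_dvd_sum2sq (p : nat) : prime p -> odd p ->
  exists a b : nat, (a.*2 < p)%N /\ (b.*2 < p)%N /\ (p %| a ^ 2 + b ^ 2 + 1)%N.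
Proof.
move=> pp op; have p1 := prime_gt1 pp.
have sq_inj (a b : nat) : (a.*2 < p)%N -> (b.*2 < p)%N ->
    (p%:Z %| (a%:Z ^+ 2 - b%:Z ^+ 2)%R)%Z -> a = b.
  move=> ha hb; rewrite subr_sqr dvdzE abszM Euclid_dvdM // => /orP[].
    move=> /dvdnP[k hk]; case: k hk => [|k] hk; first by lia.
    have : (p <= k.+1 * p)%N by rewrite leq_pmull.
    by lia.
  move=> /dvdnP[k hk]; case: k hk => [|k] hk; first by lia.
  have : (p <= k.+1 * p)%N by rewrite leq_pmull.
  by lia.
have ltmod (z : int) : (`|(z %% p)%Z|%N < p)%N by lia.
pose f (x : 'I_p./2.+1 + 'I_p./2.+1) : 'I_p :=
  match x with
  | inl a => Ordinal (ltmod (a%:Z ^+ 2))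
  | inr b => Ordinal (ltmod (- 1 - b%:Z ^+ 2))
  end.
have valf z w : `|(z %% p)%Z|%N = `|(w %% p)%Z|%N -> (p%:Z %| (z - w)%R)%Z.
  move=> h; rewrite -eqz_mod_dvd; apply/eqP.
  by move: (modz_ge0 z (d := p)) (modz_ge0 w (d := p)) => /(_ ltac:(lia)) ? /(_ ltac:(lia)) ?; lia.
have lt2 (a : 'I_p./2.+1) : (a.*2 < p)%N.
  by have := ltn_ord a; have := odd_double_half p; rewrite op; lia.
have /injectivePn [x [y xy fxy]] : ~~ injectiveb f.
  apply/negP => /injectiveP /leq_card; rewrite card_sum !card_ord.
  by have := odd_double_half p; rewrite op; lia.
have fin (a b : 'I_p./2.+1) : (p%:Z %| (a%:Z ^+ 2 - (-1 - b%:Z ^+ 2))%R)%Z ->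
    (p %| a ^ 2 + b ^ 2 + 1)%N.
  have -> : a%:Z ^+ 2 - (-1 - b%:Z ^+ 2) = (a ^ 2 + b ^ 2 + 1)%N%:Z.
    by rewrite !PoszD -!(rmorphXn Posz); ring.
  by rewrite dvdzE.
case: x y xy fxy => [a|a] [b|b] xy; move=> /(congr1 val) /= /valf.
- move=> h; case/eqP: xy; congr inl; apply: val_inj.
  exact: (sq_inj _ _ (lt2 a) (lt2 b) h).
- by move=> h; exists a, b; split=> //; split=> //; apply: fin.
- move=> h; exists b, a; split=> //; split=> //; apply: fin.
  rewrite (_ : _ - _ = - (-1 - a%:Z ^+ 2 - b%:Z ^+ 2)); last by ring.
  by rewrite rpredN.
- move=> h; case/eqP: xy; congr inr; apply: val_inj.
  apply: (sq_inj _ _ (lt2 a) (lt2 b)); rewrite -rpredN.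
  by rewrite (_ : - _ = -1 - a%:Z ^+ 2 - (-1 - b%:Z ^+ 2)) //; ring.
Qed.

Lemma centered_mod (m x : int) : 0 < m ->
  exists a k : int, x = a + m * k /\ - m < 2 * a <= m.
Proof.
move=> m0; have e := divz_eq x m; have h0 := modz_ge0 x (lt0r_neq0 m0).
have h1 := ltz_pmod x m0.
have [h|h] := lerP (2 * (x %% m)%Z) m.
  by exists (x %% m)%Z, (x %/ m)%Z; split; [rewrite {1}e; ring | lia].
exists ((x %% m)%Z - m), ((x %/ m)%Z + 1); split; last by lia.
by rewrite {1}e; ring.
Qed.

Lemma centered_sqr_le (m t : int) : - m < 2 * t <= m -> 4 * t ^+ 2 <= m ^+ 2.
Proof.
move=> /andP[h1 h2]; rewrite -subr_ge0.
have -> : m ^+ 2 - 4 * t ^+ 2 = (m - 2 * t) * (m + 2 * t) by ring.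
by apply: mulr_ge0; lia.
Qed.

(** The interval is half-open, which excludes 2t = -m. *)
Lemma centered_sqr_eq (m t : int) :
  - m < 2 * t <= m -> 4 * t ^+ 2 = m ^+ 2 -> 2 * t = m.
Proof.
move=> /andP[h1 h2] e; have /eqP : (m - 2 * t) * (m + 2 * t) = 0.
  by transitivity (m ^+ 2 - 4 * t ^+ 2); [ring | rewrite e subrr].
by rewrite mulf_eq0 => /orP[] /eqP; lia.
Qed.

(** Lagrange's descent: the least absolute residues a, b, c, d of x, y, z, w modulo m have squares
    adding up to m r with 0 <= r <= m. Both extremes would make m divide p; otherwise r p is a sum
    of four squares with 0 < r < m. *)
Lemma sum4sq_descent (p : nat) : prime p -> forall m : nat,
  (0 < m < p)%N -> sum4sq (m%:Z * p%:Z) -> sum4sq p%:Z.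
Proof.
move=> pp; elim/ltn_ind => m IH /andP[m0 mp] [x [y [z [w E]]]].
have [m1|m1] := eqVneq m 1%N; first by exists x, y, z, w; rewrite -E m1 mul1r.
have mZ : (0 < m%:Z :> int) by lia.
have nmp : forall q : int, p%:Z <> m%:Z * q.
  move=> q /(congr1 absz); rewrite abszM /= => hq.
  have : (m %| p)%N by apply/dvdnP; exists `|q|%N; rewrite mulnC.
  by move/(prime_nt_dvdP pp m1) => e; move: mp; rewrite e ltnn.
have [a [k [hx ha]]] := @centered_mod _ x mZ.
have [b [l [hy hb]]] := @centered_mod _ y mZ.
have [c [i [hz hc]]] := @centered_mod _ z mZ.
have [d [j [hw hd]]] := @centered_mod _ w mZ.
pose r : int := p%:Z - (2 * a * k + 2 * b * l + 2 * c * i + 2 * d * j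
   + m%:Z * (k ^+ 2 + l ^+ 2 + i ^+ 2 + j ^+ 2)).
have Er : m%:Z * r = a ^+ 2 + b ^+ 2 + c ^+ 2 + d ^+ 2.
  by rewrite /r mulrBr E hx hy hz hw; ring.
have rm : r <= m.
  have := centered_sqr_le ha; have := centered_sqr_le hb.
  have := centered_sqr_le hc; have := centered_sqr_le hd.
    move=> h1 h2 h3 h4; suff: m%:Z * r <= m%:Z * m%:Z by rewrite ler_pM2l.
  by rewrite Er -expr2; move: h1 h2 h3 h4; clear; lia.
have r0 : 0 <= r.
  suff: 0 <= m%:Z * r by rewrite pmulr_rge0.
  by rewrite Er !addr_ge0 ?sqr_ge0.
have [rz|rnz] := eqVneq r 0.
  have [az bz cz dz] : [/\ a = 0, b = 0, c = 0 & d = 0].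
    move: Er; rewrite rz mulr0 => Er.
    have := sqr_ge0 a; have := sqr_ge0 b; have := sqr_ge0 c; have := sqr_ge0 d.
    by move: Er; clear => ?????; split; apply/eqP; rewrite -sqrf_eq0; apply/eqP; lia.
  case: (nmp (k ^+ 2 + l ^+ 2 + i ^+ 2 + j ^+ 2)).
  by apply/eqP; rewrite -subr_eq0 -rz /r az bz cz dz; apply/eqP; ring.
have [rem|rnm] := eqVneq r m.
  have := centered_sqr_le ha; have := centered_sqr_le hb.
  have := centered_sqr_le hc; have := centered_sqr_le hd.
  move: Er; rewrite rem -expr2 => Er h1 h2 h3 h4.
  have e1 : 2 * a = m by apply: (centered_sqr_eq ha); move: Er h1 h2 h3 h4; clear; lia.
  have e2 : 2 * b = m by apply: (centered_sqr_eq hb); move: Er h1 h2 h3 h4; clear; lia.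
  have e3 : 2 * c = m by apply: (centered_sqr_eq hc); move: Er h1 h2 h3 h4; clear; lia.
  have e4 : 2 * d = m by apply: (centered_sqr_eq hd); move: Er h1 h2 h3 h4; clear; lia.
  case: (nmp (1 + k + l + i + j + k ^+ 2 + l ^+ 2 + i ^+ 2 + j ^+ 2)).
  move: rem; rewrite /r e1 e2 e3 e4 => rem.
  by move/eqP: rem; rewrite subr_eq => /eqP ->; ring.
have [rp rn] : (0 < `|r|%N)%N /\ (`|r|%N < m)%N.
  by move: r0 rm rnz rnm; clear; lia.
apply: (IH `|r|%N) => //; first by rewrite rp (ltn_trans rn).
rewrite gez0_abs //.
(* Euler's identity for (x, y, z, w) and (a, b, c, d), each coordinate divided by m. *)
exists (r + (k * a + l * b + i * c + j * d)), (k * b - l * a + i * d - j * c),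
  (k * c - i * a + j * b - l * d), (k * d - j * a + l * c - i * b).
apply: (mulfI (lt0r_neq0 mZ)); apply: (mulfI (lt0r_neq0 mZ)).
transitivity ((m%:Z * p) * (m%:Z * r)); first by ring.
transitivity ((m%:Z * r + m%:Z * (k * a + l * b + i * c + j * d)) ^+ 2
  + m%:Z ^+ 2 * ((k * b - l * a + i * d - j * c) ^+ 2
  + (k * c - i * a + j * b - l * d) ^+ 2 + (k * d - j * a + l * c - i * b) ^+ 2)); last by ring.
by rewrite E Er hx hy hz hw; ring.
Qed.

Lemma sum4sq_prime (p : nat) : prime p -> sum4sq p%:Z.
Proof.
move=> pp; have [->|op] := even_prime pp; first by exists 1, 1, 0, 0.
have [a [b [ha [hb /dvdnP[m Em]]]]] := prime_dvd_sum2sq pp op.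
apply: (sum4sq_descent pp (m := m)).
  have m0 : (0 < m)%N by case: m Em => //; rewrite mul0n addn1.
  rewrite m0 -(ltn_pmul2r (prime_gt0 pp)) -Em -!mulnn.
  by move: ha hb (prime_gt1 pp); clear; nia.
exists a%:Z, b%:Z, 1, 0; rewrite -PoszM -Em.
by rewrite !PoszD -!(rmorphXn Posz); ring.
Qed.

Lemma sum4sq_nat (n : nat) : sum4sq n%:Z.
Proof.
elim/ltn_ind: n => n IH; have [n1|n1] := leqP n 1.
  by case: n n1 {IH} => [|[|//]] _; [exists 0, 0, 0, 0 | exists 1, 0, 0, 0].
have pp := pdiv_prime n1; rewrite -(divnK (pdiv_dvd n)) PoszM.
apply: sum4sqM; last exact: sum4sq_prime.
by apply: IH; rewrite ltn_Pdiv ?prime_gt1 //; lia.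
Qed.

(** * The ring of integers *)

(** The monic integer polynomial keeps its rational root when [F] is replaced by [algC], where
    rational algebraic integers are integers. *)
Lemma rat_integral_int (F : numFieldType) (q : rat) :
  integralOver (intr : int -> F) (ratr q) -> exists z : int, q = z%:~R.
Proof.
case=> p pm rp.
have rq : root (map_poly intr p : {poly rat}) q.
  rewrite -(fmorph_root (ratr : {rmorphism rat -> F})) -map_poly_comp.
  by rewrite (eq_map_poly (g := intr)) // => z /=; rewrite ratr_int.
have rC : root (map_poly intr p : {poly algC}) (ratr q).
  move: rq; rewrite -(fmorph_root (ratr : {rmorphism rat -> algC})) -map_poly_comp.
  by rewrite (eq_map_poly (g := intr)) // => z /=; rewrite ratr_int.
have Aq : (ratr q : algC) \in Aint.
  apply: (root_monic_Aint rC); first by rewrite monic_map.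
  by apply/polyOverP => i; rewrite coef_map; exact: intr_int.
have /intrP[z hz] := Cint_rat_Aint (Crat_rat q) Aq.
have /fmorph_inj e : ratr q = ratr z%:~R :> algC by rewrite hz ratr_int.
by exists z.
Qed.

Section RealQuadratic.
Variables (R : realType) (D : nat).
Hypotheses (D_gt1 : (1 < D)%N) (D_sqfree : squarefree D).
Local Notation em := (emb R D).
Local Notation cj x := (emb R D (conjK x)).
Local Notation mul := (mulK D).
Local Notation om := (omegaD D).
Local Notation u := (cf_u R D).
Local Notation xi := (cf_xi R D).
Local Notation al := (alpha R D).
Local Notation alr := (alphar R D).

(** * Embedding and conjugation on Q(sqrt D) *)

Lemma cjE x : cj x = ratr x.1 - ratr x.2 * sqrtD R D.
Proof. by rewrite /emb /conjK /= rmorphN mulNr. Qed.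

Lemma embD x y : em (addK x y) = em x + em y.
Proof. by rewrite /emb /= !rmorphD /=; ring. Qed.

Lemma sqrtD_sq : sqrtD R D ^+ 2 = D%:R.
Proof. by rewrite sqr_sqrtr // ler0n. Qed.

Lemma embM x y : em (mul x y) = em x * em y.
Proof.
rewrite /emb /= !rmorphD /= !rmorphM /= ratr_nat -sqrtD_sq; ring.
Qed.

Lemma conjKD x y : conjK (addK x y) = addK (conjK x) (conjK y).
Proof. by rewrite /conjK /addK /= opprD. Qed.

Lemma conjKM x y : conjK (mul x y) = mul (conjK x) (conjK y).
Proof. by rewrite /conjK /mulK /=; congr pair; ring. Qed.

Lemma conjKK x : conjK (conjK x) = x.
Proof. by case: x => a b; rewrite /conjK /= opprK. Qed.

Lemma cjD x y : cj (addK x y) = cj x + cj y.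
Proof. by rewrite conjKD embD. Qed.

Lemma cjM x y : cj (mul x y) = cj x * cj y.
Proof. by rewrite conjKM embM. Qed.

Lemma embZ z : em (intK z) = z%:~R.
Proof. by rewrite /emb /= ratr_int rmorph0 mul0r addr0. Qed.

Lemma cjZ z : cj (intK z) = z%:~R.
Proof. by rewrite /conjK /= oppr0 -/(intK z) embZ. Qed.

Lemma emb1 : em oneK = 1. Proof. exact: (embZ 1). Qed.
Lemma cj1 : cj oneK = 1. Proof. exact: (cjZ 1). Qed.

(** In lowest terms the square of the denominator divides D, so squarefreeness forces the
    denominator to be 1. *)
Lemma sqfree_rat (q : rat) (z : int) : q ^+ 2 * D%:R = z%:~R ->
  exists y : int, q = y%:~R.
Proof.
move=> e.
have dn0 : (denq q)%:~R != 0 :> rat by rewrite intr_eq0 denq_neq0.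
have e1 : (numq q) ^+ 2 * D%:Z = z * (denq q) ^+ 2.
  apply: (intr_inj (R := rat)); rewrite !rmorphM /= ?rmorphXn /= numqE -e.
  ring.
have cop : coprime (`|denq q| ^ 2) (`|numq q| ^ 2).
  by rewrite coprimeXl // coprimeXr // coprime_sym coprime_num_den.
have dD : (`|denq q| * `|denq q| %| D)%N.
  rewrite mulnn -(Gauss_dvdr _ cop).
  by apply/dvdnP; exists `|z|%N; move: (congr1 absz e1); rewrite !abszM mulnn mulnn.
have [d1|d1] := leqP `|denq q| 1.
  exists (numq q); rewrite -[LHS]divq_num_den.
  have -> : denq q = 1 by have := denq_gt0 q; lia.
  by rewrite divr1.
have /negP[] := D_sqfree (pdiv_prime d1).
by apply: dvdn_trans dD; rewrite dvdn_mul ?pdiv_dvd.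
Qed.

Lemma rat_sqr_neqD (q : rat) : q ^+ 2 != D%:R.
Proof.
apply/eqP=> e; have [z hz] : exists z : int, q = z%:~R.
  (* If q^2 = D then q / D has square 1 / D, so it is an integer and q is an integer multiple of
     D. *)
  have: (q / D%:R) ^+ 2 * D%:R = 1%:~R.
    by rewrite exprMn e expr2; field; rewrite pnatr_eq0; lia.
  case/sqfree_rat => y hy; exists (y * D%:Z); rewrite rmorphM /= -hy.
  by rewrite mulfVK // pnatr_eq0; lia.
have hD : (`|z| ^ 2)%N = D.
  by move: e; rewrite hz -rmorphXn -[D%:R]/(D%:Z%:~R) => /intr_inj /(congr1 absz); rewrite abszX.
have z1 : (1 < `|z|)%N by move: hD D_gt1; case: `|z|%N => [|[|]] //= <-.
have /negP[] := D_sqfree (pdiv_prime z1).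
by rewrite -hD -mulnn dvdn_mul ?pdiv_dvd.
Qed.

Lemma emb_eq0 x : em x = 0 -> x = (0, 0).
Proof.
case: x => a b; rewrite /emb /= => e.
have [b0|b0] := eqVneq b 0.
  move: e; rewrite b0 rmorph0 mul0r addr0 => /eqP.
  by rewrite fmorph_eq0 => /eqP ->.
case/eqP: (rat_sqr_neqD (a / b)).
apply: (fmorph_inj (ratr : {rmorphism rat -> R})); rewrite /= ratr_nat -sqrtD_sq.
rewrite rmorphXn fmorph_div /=.
have -> : ratr a = - (ratr b * sqrtD R D) by apply/eqP; rewrite -addr_eq0 e.
by field; rewrite fmorph_eq0.
Qed.

(** Lets identities in K be proved by computation in [R]. *)
Lemma emb_inj : injective em.
Proof.
move=> [a b] [a' b'] e.
have /emb_eq0 [/eqP h1 /eqP h2] : em (a - a', b - b') = 0.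
  by transitivity (em (a, b) - em (a', b')); [rewrite /emb /= !rmorphB /=; ring | rewrite e subrr].
by move: h1 h2; rewrite !subr_eq0 => /eqP -> /eqP ->.
Qed.

Lemma cj_inj x y : cj x = cj y -> x = y.
Proof. by move/emb_inj/(congr1 conjK); rewrite !conjKK. Qed.

(* [omegaD] is a root of [X^2 - trO X + nmO]. *)
Definition trO : int := if (D %% 4 == 1)%N then 1 else 0.
Definition nmO : int := if (D %% 4 == 1)%N then - (D %/ 4)%:Z else - D%:Z.
Definition lat (m n : int) : Kel := addK (intK m) (mul (intK n) om).
(** The explicit form Z + Z omega of the ring of integers; [inL_OK] and [inOK_L] identify the
    two. *)
Definition inL (x : Kel) : Prop := exists m n : int, x = lat m n.

Lemma om_quad : em om ^+ 2 = trO%:~R * em om - nmO%:~R.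
Proof.
rewrite /emb /omegaD /trO /nmO; case: ifP => [/eqP d1|d1] /=.
  rewrite fmorph_div /= rmorph1 ratr_nat.
  have := sqrtD_sq; have -> : D%:R = 4 * (D %/ 4)%:R + 1 :> R.
    by rewrite {1}(divn_eq D 4) d1 natrD natrM mulrC.
  by move=> e; rewrite rmorphN /= -[(Posz _)%:~R]/((D %/ 4)%:R); nra.
by rewrite rmorph0 rmorph1 add0r mul1r mul0r rmorphN /= sqrtD_sq sub0r opprK.
Qed.

Lemma om_trace : em om + cj om = trO%:~R.
Proof.
rewrite cjE /emb /omegaD /trO; case: ifP => _ /=.
  by rewrite fmorph_div /= rmorph1 ratr_nat; field.
by rewrite !rmorph0 rmorph1; ring.
Qed.

Lemma om_norm : em om * cj om = nmO%:~R.
Proof.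
have -> : cj om = trO%:~R - em om by rewrite -om_trace; ring.
by rewrite mulrBr -expr2 om_quad; ring.
Qed.

Lemma lat_emb m n : em (lat m n) = m%:~R + n%:~R * em om.
Proof. by rewrite embD embM !embZ. Qed.

Lemma lat_cj m n : cj (lat m n) = m%:~R + n%:~R * cj om.
Proof. by rewrite cjD cjM !cjZ. Qed.

Lemma inL_Z z : inL (intK z).
Proof.
by exists z, 0; apply: emb_inj; rewrite lat_emb embZ mul0r addr0.
Qed.

Lemma inL_add x y : inL x -> inL y -> inL (addK x y).
Proof.
move=> [a [b ->]] [c [d ->]]; exists (a + c), (b + d); apply: emb_inj.
by rewrite embD !lat_emb !rmorphD /=; ring.
Qed.

Lemma inL_mul x y : inL x -> inL y -> inL (mul x y).
Proof.
move=> [a [b ->]] [c [d ->]].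
exists (a * c - b * d * nmO), (a * d + b * c + b * d * trO); apply: emb_inj.
rewrite embM !lat_emb !rmorphB !rmorphD /= !rmorphM /=.
have := om_quad; set w := em om => e.
transitivity (a%:~R * c%:~R + (a%:~R * d%:~R + b%:~R * c%:~R) * w
  + b%:~R * d%:~R * w ^+ 2); first by ring.
by rewrite e; ring.
Qed.

Lemma inL_conj x : inL x -> inL (conjK x).
Proof.
move=> [a [b ->]]; exists (a + b * trO), (- b); apply: emb_inj.
rewrite lat_cj lat_emb !rmorphD rmorphM /= -om_trace rmorphN /=; ring.
Qed.

Lemma inL_norm x : inL x -> exists n : int, em x * cj x = n%:~R.
Proof.
move=> [a [b hab]]; exists (a ^+ 2 + a * b * trO + b ^+ 2 * nmO).
rewrite hab lat_emb lat_cj !rmorphD !rmorphM /= -om_trace -om_norm; ring.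
Qed.

Lemma inL_OK x : inL x -> inOK R D x.
Proof.
move=> hx; have [a [b hab]] := hx.
have [t ht] : exists t : int, em x + cj x = t%:~R.
  exists (2 * a + b * trO); rewrite hab lat_emb lat_cj rmorphD !rmorphM /= -om_trace; ring.
have [n hn] := inL_norm hx.
exists ('X^2 - t *: 'X + n%:P); split.
  rewrite monicE lead_coefDl ?lead_coefDl ?lead_coefXn //.
    rewrite size_polyN size_polyXn (leq_ltn_trans (size_scale_leq _ _)) //.
    by rewrite size_polyX.
  rewrite size_polyC size_addl ?size_polyXn //; first by case: eqP.
  rewrite size_polyN (leq_ltn_trans (size_scale_leq _ _)) //.
  by rewrite size_polyX.
rewrite rootE !rmorphD rmorphN /= map_polyXn map_polyZ /= map_polyX map_polyC /=.
by rewrite !hornerE -ht -hn; apply/eqP; ring.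
Qed.

(** Conjugation is a ring automorphism fixing the integers, so it commutes with evaluation; hence a
    root stays a root under conjugation. *)
Lemma horner_conj (p : {poly int}) x : exists u v : rat,
  (map_poly intr p).[em x] = em (u, v) /\ (map_poly intr p).[cj x] = em (u, - v).
Proof.
elim/poly_ind: p => [|p c [u [v [h1 h2]]]].
  by exists 0, 0; rewrite rmorph0 !horner0 /emb /= oppr0 !rmorph0 mul0r addr0.
have [u' [v' E]] : exists u' v', (u', v') = addK (mul (u, v) x) (intK c).
  by case: (addK _ _) => u' v'; exists u', v'.
exists u', v'; rewrite -[(u', - v')]/(conjK (u', v')) E.
rewrite embD embM embZ cjD cjM cjZ.
by rewrite !rmorphD /= !rmorphM /= map_polyX map_polyC /= !hornerE h1 h2.
Qed.

Lemma inOK_conj x : inOK R D x -> inOK R D (conjK x).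
Proof.
case=> p [pm rp]; exists p; split=> //; rewrite rootE.
have [u [v [h1 h2]]] := horner_conj p x.
move: rp; rewrite rootE h1 => /eqP /emb_eq0 [u0 v0].
by rewrite h2 u0 v0 oppr0 /emb /= !rmorph0 mul0r addr0.
Qed.

(** The trace A = 2a and the norm N are integers, so D (2b)^2 = A^2 - 4N is one and B = 2b is an
    integer by [sqfree_rat]. Then A^2 - D B^2 = 4N modulo 4 gives A and B equal parity if D is 1
    modulo 4, and makes both even otherwise. *)
Lemma inOK_L x : inOK R D x -> inL x.
Proof.
move=> hx; have := inOK_conj hx; have := hx; case: x {hx} => a b.
move=> [p [pm rp]] [q [qm rq]].
have I1 : integralOver (intr : int -> R) (em (a, b)) by exists p.
have I2 : integralOver (intr : int -> R) (cj (a, b)) by exists q.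
have [A hA] : exists A : int, 2 * a = A%:~R.
  apply: (@rat_integral_int R); have := integral_add I1 I2.
  by congr integralOver; rewrite cjE /emb rmorphM /= ratr_nat; ring.
have [N hN] : exists N : int, a ^+ 2 - D%:R * b ^+ 2 = N%:~R.
  apply: (@rat_integral_int R); have := integral_mul I1 I2.
  congr integralOver; rewrite cjE /emb rmorphB !rmorphM /= ratr_nat -sqrtD_sq; ring.
have [B hB] : exists B : int, 2 * b = B%:~R.
  apply: (@sqfree_rat _ (A ^+ 2 - 4 * N)).
  by rewrite rmorphB !rmorphM /= -hA -hN; ring.
have E : A ^+ 2 - D%:Z * B ^+ 2 = 4 * N.
  apply: (intr_inj (R := rat)).
  by rewrite rmorphB !rmorphM /= -hA -hN -hB -[D%:~R]/(D%:R); ring.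
have D4 : (D %% 4 != 0)%N.
  exact: (D_sqfree (isT : prime 2)).
have [A1 [a1 [EA ha1]]] : exists A1 a1, A = 2 * A1 + a1 /\ (a1 = 0 \/ a1 = 1).
  by exists (A %/ 2)%Z, (A %% 2)%Z; lia.
have [B1 [b1 [EB hb1]]] : exists A1 a1, B = 2 * A1 + a1 /\ (a1 = 0 \/ a1 = 1).
  by exists (B %/ 2)%Z, (B %% 2)%Z; lia.
have ED : D%:Z = 4 * (D %/ 4)%N%:Z + (D %% 4)%N%:Z by lia.
have Dlt : (D %% 4 < 4)%N by rewrite ltn_mod.
have par : if (D %% 4 == 1)%N then a1 = b1 else a1 = 0 /\ b1 = 0.
  move: E; rewrite ED EA EB.
  move: (D %/ 4)%N (D %% 4)%N D4 Dlt => D1 d.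
  by case: d => [|[|[|[|]]]] //= _ _; case: ha1 => ->; case: hb1 => ->; nia.
have aE : a = A%:~R / 2 by rewrite -hA; field.
have bE : b = B%:~R / 2 by rewrite -hB; field.
rewrite aE bE EA EB /inL /lat /omegaD; move: par.
case: ifP => _ par.
  rewrite par; exists (A1 - B1), (2 * B1 + b1).
  by rewrite /addK /mulK /intK /=; congr pair; rewrite !rmorphD ?rmorphB /= ?rmorphM /=; field.
case: par => -> ->; exists A1, B1.
by rewrite /addK /mulK /intK /=; congr pair; rewrite !rmorphD /= ?rmorphM /=; field.
Qed.


(** * The elements alpha_{i,r} *)

Lemma sqrtD_gt1 : 1 < sqrtD R D.
Proof. by rewrite -sqrtr1 ltr_sqrt ?ltr1n ?ltr0n // ltnW. Qed.

Lemma em_om_gt1 : 1 < em om.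
Proof.
have h := sqrtD_gt1; rewrite /emb /omegaD; case: ifP => _ /=.
  by rewrite fmorph_div /= rmorph1 ratr_nat; lra.
by rewrite rmorph0 rmorph1 add0r mul1r.
Qed.

Lemma cj_om_lt0 : cj om < 0.
Proof.
have h := sqrtD_gt1; rewrite cjE /omegaD; case: ifP => _ /=.
  by rewrite fmorph_div /= rmorph1 ratr_nat; lra.
by rewrite rmorph0 rmorph1; lra.
Qed.

Lemma em_al j : em (al j) = (pq R D j).1%:~R - (pq R D j).2%:~R * cj om.
Proof. by rewrite /alpha embD embM !embZ rmorphN mulNr. Qed.

Lemma cj_al j : cj (al j) = (pq R D j).1%:~R - (pq R D j).2%:~R * em om.
Proof. by rewrite /alpha cjD cjM !cjZ conjKK rmorphN mulNr. Qed.

Lemma em_al0 : em (al 0) = 1. Proof. by rewrite em_al /= mul0r subr0. Qed.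
Lemma cj_al0 : cj (al 0) = 1. Proof. by rewrite cj_al /= mul0r subr0. Qed.
Lemma em_al1 : em (al 1) = (u 0)%:R - cj om.
Proof. by rewrite em_al /= mul1r. Qed.
Lemma cj_al1 : cj (al 1) = (u 0)%:R - em om.
Proof. by rewrite cj_al /= mul1r. Qed.

Lemma em_alSS j : em (al j.+2) = (u j.+1)%:R * em (al j.+1) + em (al j).
Proof. by rewrite !em_al -/pq !rmorphD !rmorphM /=; ring. Qed.

Lemma cj_alSS j : cj (al j.+2) = (u j.+1)%:R * cj (al j.+1) + cj (al j).
Proof. by rewrite !cj_al !rmorphD !rmorphM /=; ring. Qed.

Lemma em_al_gt0 j : 0 < em (al j).
Proof.
suff : 0 < em (al j) /\ 0 < em (al j.+1) by case.
elim: j => [|j [h1 h2]].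
  rewrite em_al0 em_al1; split=> //; have := cj_om_lt0; have := ler0n R (u 0); lra.
split=> //; rewrite em_alSS ltr_wpDl // mulr_ge0 // ltW //.
Qed.

Lemma cj_eq0 x : cj x = 0 -> em x = 0.
Proof.
move/(emb_eq0); case: x => a b [-> /eqP]; rewrite oppr_eq0 => /eqP ->.
by rewrite /emb /= !rmorph0 mul0r addr0.
Qed.

Lemma cj_al_neq0 j : cj (al j) != 0.
Proof.
by apply/eqP => /cj_eq0 h; have := em_al_gt0 j; rewrite h ltxx.
Qed.

(** Complete quotients are ratios of consecutive conjugates, up to sign. Both claims go into one
    induction: 1 < [xi] identifies [u] with the floor, and the nonvanishing of the conjugates shows
    that the fractional part to be inverted is not 0. *)
Lemma xi_spec j : 1 < xi j /\ cj (al j.+1) = - cj (al j) * (xi j - (u j)%:R).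
Proof.
have ufl i : 1 < xi i -> (u i)%:R = (Num.floor (xi i))%:~R :> R.
  by move=> h; rewrite /cf_u natr_absz ger0_norm // floor_ge0; lra.
elim: j => [|j [h1 h2]].
  by split; [exact: em_om_gt1 | rewrite cj_al0 cj_al1 /=; ring].
have e : xi j.+1 = (xi j - (u j)%:R)^-1 by rewrite ufl.
have x0 : 0 < xi j - (u j)%:R.
  rewrite lt_neqAle eq_sym; apply/andP; split; last by rewrite ufl // subr_ge0 floor_le.
  by apply/negP => /eqP x0; have := cj_al_neq0 j.+1; rewrite h2 x0 mulr0 eqxx.
have x1 : xi j - (u j)%:R < 1.
  by have := floorD1_gt (xi j); rewrite rmorphD /= -ufl // => ?; lra.
split; first by rewrite e invf_gt1.
rewrite cj_alSS {1}(_ : cj (al j) = - cj (al j.+1) * xi j.+1); first by ring.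
by rewrite h2 e; field; lra.
Qed.

Lemma xi_gt1 j : 1 < xi j. Proof. by case: (xi_spec j). Qed.

Lemma xiS j : cj (al j) = - cj (al j.+1) * xi j.+1.
Proof.
have [_] := xi_spec j.+1; rewrite cj_alSS => /eqP.
by rewrite -(inj_eq (addrI (- ((u j.+1)%:R * cj (al j.+1))))) addKr => /eqP ->; ring.
Qed.

Lemma u_floor j : (u j)%:R = (Num.floor (xi j))%:~R :> R.
Proof. by rewrite /cf_u natr_absz ger0_norm // floor_ge0 ltW // (lt_trans ltr01) ?xi_gt1. Qed.

Lemma u_gt0 j : (0 < u j)%N.
Proof.
by rewrite -(ltr_nat R) u_floor ltr0z floor_gt0 ltW // xi_gt1.
Qed.

Lemma cj_al_sign j : if odd j then cj (al j) < 0 else 0 < cj (al j).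
Proof.
elim: j => [|j]; first by rewrite cj_al0 ltr01.
have := xi_gt1 j.+1; rewrite xiS [odd j.+1]/=; case: (odd j) => h0 h1 /=; nra.
Qed.

Lemma cj_al_even j : ~~ odd j -> 0 < cj (al j).
Proof. by have := cj_al_sign j; case: odd. Qed.

Lemma cj_al_odd j : odd j -> cj (al j) < 0.
Proof. by have := cj_al_sign j; case: odd. Qed.

Lemma em_al_ltS j : em (al j) < em (al j.+1).
Proof.
case: j => [|j].
  by rewrite em_al0 em_al1; have := u_gt0 0; rewrite -(ler_nat R); have := cj_om_lt0; lra.
have := em_al_gt0 j.+1; have := em_al_gt0 j; rewrite em_alSS.
by have := u_gt0 j.+1; rewrite -(ler_nat R); nra.
Qed.

Lemma em_al_le i j : (i <= j)%N -> em (al i) <= em (al j).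
Proof.
by move/(homo_leq (@lexx _ _) (@le_trans _ _) (fun n => ltW (em_al_ltS n))).
Qed.

Lemma em_al_ge1 j : 1 <= em (al j).
Proof. by rewrite -em_al0 em_al_le. Qed.

Lemma em_alr j r : em (alr j r) = em (al j) + r%:R * em (al j.+1).
Proof. by rewrite /alphar embD embM embZ. Qed.

Lemma cj_alr j r : cj (alr j r) = cj (al j) + r%:R * cj (al j.+1).
Proof. by rewrite /alphar cjD cjM cjZ. Qed.

Lemma em_alr_u j : em (alr j (u j.+1)) = em (al j.+2).
Proof. by rewrite em_alr em_alSS addrC. Qed.

Lemma cj_alr_u j : cj (alr j (u j.+1)) = cj (al j.+2).
Proof. by rewrite cj_alr cj_alSS addrC. Qed.

Lemma em_alr_lt j r r' : (r < r')%N -> em (alr j r) < em (alr j r').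
Proof.
by rewrite !em_alr ltrD2l ltr_pM2r ?em_al_gt0 // ltr_nat.
Qed.

Lemma em_alr_le j r r' : (r <= r')%N -> em (alr j r) <= em (alr j r').
Proof. by rewrite !em_alr lerD2l ler_pM2r ?em_al_gt0 // ler_nat. Qed.

Lemma em_alr_ge j r : em (al j) <= em (alr j r).
Proof. by rewrite em_alr lerDl mulr_ge0 // ltW // em_al_gt0. Qed.

Lemma em_alr_lt_al j j' r : ~~ odd j -> ~~ odd j' -> (j < j')%N ->
  (r < u j.+1)%N -> em (alr j r) < em (al j').
Proof.
move=> oj oj' jj' ru; apply: lt_le_trans (em_al_le (i := j.+2) _).
  by rewrite -em_alr_u em_alr_lt.
rewrite ltn_neqAle jj' andbT; apply/eqP => e; by move: oj'; rewrite -e /= oj.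
Qed.

Lemma cj_alr_gt0 j r : ~~ odd j -> (r <= u j.+1)%N -> 0 < cj (alr j r).
Proof.
move=> oj ru; have o2 : ~~ odd j.+2 by rewrite /= negbK.
apply: lt_le_trans (cj_al_even o2) _; rewrite -cj_alr_u !cj_alr lerD2l.
have := @cj_al_odd j.+1 oj; move: ru; rewrite -(ler_nat R); nra.
Qed.

Lemma cj_al_even_le j : ~~ odd j -> cj (al j) <= 1.
Proof.
move=> /negbTE oj; rewrite -(odd_double_half j) oj add0n.
elim: (j./2) => [|k IH]; first by rewrite cj_al0.
apply: le_trans IH; rewrite doubleS -cj_alr_u cj_alr gerDl.
by rewrite pmulr_rle0 ?ltr0n ?u_gt0 // ltW // cj_al_odd //= odd_double.
Qed.

Lemma cj_alr_le1 j r : ~~ odd j -> cj (alr j r) <= 1.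
Proof.
move=> oj; apply: le_trans (cj_al_even_le oj); rewrite cj_alr gerDl.
by rewrite mulr_ge0_le0 // ltW // cj_al_odd.
Qed.

(* Euclid's algorithm on the coordinates: unless [y <= u_{j+1} x], passing to the
   basis [al j.+2, al j.+3] keeps both coordinates natural because the
   conjugate is positive. *)
Lemma cone_step j (x y : nat) : ~~ odd j -> (0 < x)%N ->
  0 < x%:R * cj (al j) + y%:R * cj (al j.+1) ->
  exists j' r e f : nat, [/\ ~~ odd j', (r < u j'.+1)%N &
    x%:R * em (al j) + y%:R * em (al j.+1) =
    e%:R * em (alr j' r) + f%:R * em (alr j' r.+1)].
Proof.
elim/ltn_ind: x j y => x IH j y oj x0 c0.
have [yux|yux] := leqP y (u j.+1 * x).
  have [ru|ru] := ltnP (y %/ x) (u j.+1).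
    (* Division of y by x: the quotient selects the cone, and the remainder is the coefficient of
       its second generator. *)
    exists j, (y %/ x)%N, (x - y %% x)%N, (y %% x)%N; split=> //.
    rewrite natrB ?(ltnW (ltn_pmod _ _)) // !em_alr -natr1.
    by rewrite {1}(divn_eq y x) natrD natrM; ring.
  have ey : y = (u j.+1 * x)%N.
    by apply/eqP; rewrite eqn_leq yux /= -leq_divRL.
  exists j.+2, 0%N, x, 0%N; split; rewrite ?negbK ?u_gt0 //.
  by rewrite em_alr em_alSS ey natrM; ring.
(* The new coordinates on [al j.+2], [al j.+3] are x - u_{j+2} y1 and y1. *)
pose y1 := (y - u j.+1 * x)%N.
have ey : y%:R = y1%:R + (u j.+1)%:R * x%:R :> R.
  by rewrite -natrM -natrD subnK // ltnW.
have y10 : 0 < y1%:R :> R by rewrite ltr0n subn_gt0.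
have o2 : ~~ odd j.+2 by rewrite /= negbK.
have d2 := cj_al_even o2; have d3 : cj (al j.+3) < 0 by apply: cj_al_odd; rewrite /= negbK.
have c1 : 0 < (x%:R - (u j.+2)%:R * y1%:R) * cj (al j.+2) + y1%:R * cj (al j.+3).
  by move: c0; rewrite ey !cj_alSS; congr (_ < _); ring.
have x1 : (u j.+2 * y1 < x)%N.
  by rewrite -(ltr_nat R) natrM; nra.
have ex : (x - u j.+2 * y1)%N%:R = x%:R - (u j.+2)%:R * y1%:R :> R.
  by rewrite natrB ?natrM // ltnW.
have y1N : (0 < y1)%N by rewrite -(ltr_nat R).
have := IH (x - u j.+2 * y1)%N _ j.+2 y1; rewrite ex; case=> //.
- by rewrite ltn_subrL muln_gt0 u_gt0 y1N.
- by rewrite subn_gt0.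
move=> j' [r [e [f [h1 h2 h3]]]]; exists j', r, e, f; split=> //.
by rewrite -h3 ey !em_alSS; ring.
Qed.

(** Change of basis from 1, omega to [al 0] = 1, [al 1] = u_0 - omega'. The condition b' <= b makes
    the coordinate of [al 1] nonnegative; then b' > 0 and the negative conjugate of [al 1] make the
    other one positive. *)
Lemma cone b : inL b -> 0 < cj b -> cj b <= em b ->
  exists j r e f : nat, [/\ ~~ odd j, (r < u j.+1)%N &
    em b = e%:R * em (alr j r) + f%:R * em (alr j r.+1)].
Proof.
case=> m [n ->]; rewrite lat_emb lat_cj => c0 ce.
have h1 := em_om_gt1; have h2 := cj_om_lt0; have htr := om_trace.
have n0 : 0 <= n by rewrite -(ler0z R); nra.
pose x : int := m - n * ((u 0)%:Z - trO).
have ex : x%:~R = m%:~R - n%:~R * ((u 0)%:R - (trO)%:~R) :> R.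
  by rewrite /x rmorphB rmorphM rmorphB.
have cx : 0 < x%:~R + n%:~R * cj (al 1).
  by move: c0; rewrite ex cj_al1 -htr; congr (_ < _); ring.
have x0 : 0 < x.
  rewrite -(ltr0z R); have := @cj_al_odd 1 isT; move: n0; rewrite -(ler0z R); nra.
have [X eX] : exists X : nat, x = X by exists `|x|%N; lia.
have [Y eY] : exists Y : nat, n = Y by exists `|n|%N; lia.
have := @cone_step 0 X Y isT; rewrite em_al0 cj_al0.
case; [lia | by move: cx; rewrite eX eY mulr1 |].
move=> j [r [e [f [k1 k2 k3]]]]; exists j, r, e, f; split=> //; rewrite -k3.
have -> : X%:R = x%:~R :> R by rewrite eX.
have -> : Y%:R = n%:~R :> R by rewrite eY.
by rewrite ex em_al1 -htr; ring.
Qed.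


(** * Periods and units *)

Lemma xi_rec j : (xi j - (u j)%:R) * xi j.+1 = 1.
Proof.
have [h1 h2] := xi_spec j.
have := xiS j; rewrite h2 => h3.
apply: (mulfI (cj_al_neq0 j)); rewrite mulr1 [RHS]h3; ring.
Qed.

Lemma xi_mul_ge2 j : 2 <= xi j * xi j.+1.
Proof.
have := xi_rec j; have := xi_gt1 j.+1.
have := u_gt0 j; rewrite -(ler_nat R); nra.
Qed.

(** Two steps multiply the difference by the product of the four later complete quotients. Steps are
    taken in pairs because a single quotient is only known to exceed 1, whereas two consecutive ones
    have product at least 2. *)
Lemma xi_diff2 m k : (forall i, u (m + i) = u (k + i)) ->
  `|xi m - xi k| * 4 <= `|xi m.+2 - xi k.+2|.
Proof.
move=> h; have h0 := h 0; have h1 := h 1; rewrite !addn0 in h0; rewrite !addn1 in h1.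
have e1 := xi_rec m; have e2 := xi_rec m.+1.
have e3 := xi_rec k; have e4 := xi_rec k.+1.
have g1 := xi_mul_ge2 m.+1; have g2 := xi_mul_ge2 k.+1.
move: h0 h1 e1 e2 e3 e4 g1 g2.
move: (xi m) (xi m.+1) (xi m.+2) (xi k) (xi k.+1) (xi k.+2) => a a1 a2 b b1 b2.
move=> -> ->; set x := (u k)%:R; set y := (u k.+1)%:R => e1 e2 e3 e4 g1 g2.
have E : a2 - b2 = (a - b) * (a1 * a2 * (b1 * b2)).
  transitivity ((((a - x) * a1) * b1 - ((b - x) * b1) * a1) * a2 * b2); last by ring.
  rewrite e1 e3 !mul1r; transitivity (a2 * ((b1 - y) * b2) - b2 * ((a1 - y) * a2)); last by ring.
  by rewrite e4 e2; ring.
rewrite E normrM ler_wpM2l // ger0_norm; nra.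
Qed.

(** Equal floors keep every such difference at most 1, while [xi_diff2] expands it by 4 each time;
    so it is 0. *)
Lemma xi_eq m k : (forall i, u (m + i) = u (k + i)) -> xi m = xi k.
Proof.
move=> h; have H N : `|xi m - xi k| * (4 ^ N)%:R <= 1.
  elim: N m k h => [|N IH] m k h.
    rewrite mulr1 ler_norml.
    have := floor_le (xi m); have := floorD1_gt (xi m).
    have := floor_le (xi k); have := floorD1_gt (xi k).
    rewrite !rmorphD /= -!(u_floor).
    have := h 0%N; rewrite !addn0 => ->; lra.
  have := IH m.+2 k.+2; rewrite -addn2 -(addn2 k) => /(_ _) h2.
  have {}h2 := h2 (fun i => _); apply: le_trans (h2 _); last first.
    by move=> i; rewrite -!addnA.
  rewrite expnS natrM mulrA ler_wpM2r // addn2 addn2; exact: xi_diff2.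
apply/eqP; rewrite -subr_eq0 -normr_le0 leNgt; apply/negP => p.
have := H (Num.bound (`|xi m - xi k|^-1)); apply/negP; rewrite -ltNge.
rewrite -ltr_pdivrMl // mulr1.
have := archi_boundP (ltW (_ : 0 < `|xi m - xi k|^-1)); rewrite invr_gt0 => /(_ p) h3.
by apply: lt_trans h3 _; rewrite ltr_nat ltn_expl.
Qed.

(** Injectivity of the embedding lifts the relation to K, where it can be conjugated. *)
Lemma em_cj_lin b x y (e f : nat) : em b = e%:R * em x + f%:R * em y ->
  cj b = e%:R * cj x + f%:R * cj y.
Proof.
move=> h; have -> : b = addK (mul (intK e) x) (mul (intK f) y).
  by apply: emb_inj; rewrite embD !embM !embZ h.
by rewrite cjD !cjM !cjZ.
Qed.

Lemma al_inL j : inL (al j).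
Proof.
apply: (inL_add (inL_Z _)); apply: (inL_mul (inL_Z _)); apply: inL_conj.
by exists 0, 1; apply: emb_inj; rewrite lat_emb mul1r add0r.
Qed.

Lemma alr_inL j r : inL (alr j r).
Proof.
by apply: (inL_add (al_inL _)); apply: inL_mul => //; [apply: inL_Z | apply: al_inL].
Qed.

(** By [xiS] the conjugates of [al j.+1] and [al j] have ratio -1 / [xi j.+1], and since [al 0] = 1
    the conjugate of [al 1] is -1 / [xi 1]. *)
Lemma al_mul_of_xi j : xi j.+1 = xi 1 -> al j.+1 = mul (al j) (al 1).
Proof.
move=> h; apply: (cj_inj); rewrite cjM.
have := xiS j; rewrite h => ->.
have := xiS 0; rewrite cj_al0 => h1.
transitivity (cj (al j.+1) * (- cj (al 1) * xi 1)); last by ring.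
by rewrite -h1 mulr1.
Qed.

Lemma xi_of_al_mul j : al j.+1 = mul (al j) (al 1) -> xi j.+1 = xi 1.
Proof.
move=> h; apply: (mulfI (cj_al_neq0 j.+1)).
apply: oppr_inj; rewrite -mulNr -xiS // h cjM.
have := xiS 0; rewrite cj_al0 => h1.
by rewrite -mulrA -mulrN -mulNr -h1 mulr1.
Qed.

Definition u_period (s : nat) : Prop := forall i, (1 <= i)%N -> u (i + s) = u i.

Lemma xi_period s : u_period s -> xi s.+1 = xi 1.
Proof. by move=> h; apply: xi_eq => i; rewrite -(h (1 + i)%N) //; congr u; lia. Qed.

Lemma period_of_xi j : xi j.+1 = xi 1 -> u_period j.
Proof.
move=> h; suff H i : xi (i.+1 + j) = xi i.+1.
  by case=> // i _; rewrite /cf_u H.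
elim: i => [|i IH]; first by rewrite add1n.
have xiE n : xi n.+1 = (xi n - (Num.floor (xi n))%:~R)^-1 by [].
by rewrite addSn xiE IH.
Qed.

(** Both sides satisfy the same recurrence in j and agree at j = 0 and j = 1. *)
Lemma al_shift s j : u_period s -> al (j + s) = mul (al s) (al j).
Proof.
move=> h; apply: (cj_inj); rewrite cjM.
suff : cj (al (j + s)) = cj (al s) * cj (al j) /\
       cj (al (j.+1 + s)) = cj (al s) * cj (al j.+1) by case.
elim: j => [|j [h1 h2]].
  by rewrite cj_al0 mulr1 add1n (al_mul_of_xi (xi_period h)) cjM.
split=> //; rewrite !addSn !cj_alSS -addSn h2 h1 h //; ring.
Qed.

Lemma wronskian j : em (al j.+1) * cj (al j) - em (al j) * cj (al j.+1) =
  (-1) ^+ j * (em om - cj om).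
Proof.
elim: j => [|j IH]; first by rewrite em_al0 cj_al0 em_al1 cj_al1; ring.
by rewrite exprS -mulrA -IH em_alSS cj_alSS; ring.
Qed.

Lemma om_sub_gt0 : 0 < em om - cj om.
Proof. by have := em_om_gt1; have := cj_om_lt0; lra. Qed.

(** As [al (1 + t)] = [al t] times [al 1], the left side of [wronskian] at t becomes the norm of
    [al t] times omega - omega'. *)
Lemma period_norm t : u_period t -> em (al t) * cj (al t) = (-1) ^+ t.
Proof.
move=> h; have := wronskian t; rewrite (al_shift 1 h) embM cjM em_al1 cj_al1 => e.
apply: (mulIf (lt0r_neq0 om_sub_gt0)); rewrite -e; ring.
Qed.

Lemma norm_ge1 x : inL x -> 0 < em x -> 0 < cj x -> 1 <= em x * cj x.
Proof.
move=> /(inL_norm) [n h] h1 h2; have := mulr_gt0 h1 h2.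
by rewrite h ltr0z => n0; rewrite ler1z.
Qed.

Lemma al_unit t : ~~ odd t -> u_period t -> unitOK R D (al t).
Proof.
move=> ot h; split; first by apply: inL_OK => //; exact: al_inL.
exists (conjK (al t)); split.
  by apply: inL_OK => //; apply: inL_conj => //; exact: al_inL.
apply: emb_inj; rewrite embM emb1 period_norm //.
by rewrite -signr_odd (negbTE ot).
Qed.

(** * Totally positive units *)

Lemma unit_norm x : unitOK R D x -> totpos R D x -> em x * cj x = 1.
Proof.
case=> hx [y [hy xy]] [p1 p2].
have hxL := inOK_L hx; have hyL := inOK_L hy.
have e1 : em x * em y = 1 by rewrite -embM xy emb1.
have e2 : cj x * cj y = 1 by rewrite -cjM xy cj1.
have n1 := norm_ge1 hxL p1 p2.
have q1 : 0 < em y by nra.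
have q2 : 0 < cj y by nra.
have n2 := norm_ge1 hyL q1 q2.
have : (em x * cj x) * (em y * cj y) = 1.
  by rewrite -[RHS]mulr1 -{1}e1 -{1}e2; ring.
by move: n1 n2; move: (em x * cj x) (em y * cj y) => a b; nra.
Qed.

(* The norm is a strictly concave function of [r], and is at least 1 at the end
   points [r = 0] and [r = u_{j+1}]. *)
Lemma alr_norm_gt1 j r : ~~ odd j -> (0 < r < u j.+1)%N ->
  1 < em (alr j r) * cj (alr j r).
Proof.
move=> oj /andP[r0 ru].
have o2 : ~~ odd j.+2 by rewrite /= negbK.
have n0 := norm_ge1 (al_inL j) (em_al_gt0 j) (cj_al_even oj).
have n2 := norm_ge1 (al_inL j.+2) (em_al_gt0 _) (cj_al_even o2).
have b1 := em_al_gt0 j.+1; have b2 := cj_al_odd (j := j.+1) oj.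
move: n2; rewrite em_alSS cj_alSS em_alr cj_alr.
move: r0 ru; rewrite -(ltr_nat R) -[(r < _)%N](ltr_nat R).
move: n0 b1 b2.
move: (em (al j)) (em (al j.+1)) (cj (al j)) (cj (al j.+1)) (u j.+1)%:R r%:R.
move=> A B a b v x n0 b1 b2 x0 xv n2.
have v0 : 0 < v by lra.
rewrite -(ltr_pM2l v0) mulr1 -subr_gt0.
have -> : v * ((A + x * B) * (a + x * b)) - v =
   (v - x) * (A * a - 1) + x * ((v * B + A) * (v * b + a) - 1)
   + x * v * (v - x) * (B * (- b)) by ring.
apply: ltr_wpDl; last by rewrite !mulr_gt0 ?oppr_gt0 // subr_gt0.
by apply: addr_ge0; apply: mulr_ge0; rewrite ?subr_ge0 // ltW.
Qed.

(** For x = e A + f B in a cone, expanding the norm gives 1 >= e^2 + f^2, since the generators have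
    norm at least 1 and the cross term is nonnegative. So x is A or B, and [alr_norm_gt1] leaves
    only the end points of the edge. *)
Lemma unit_is_al x : inL x -> 0 < cj x -> 1 < em x -> em x * cj x = 1 ->
  exists2 j, ~~ odd j & x = al j.
Proof.
move=> xL x0 x1 nx.
have [|j [r [e [f [oj ru E]]]]] := cone xL x0; first by nra.
have E' := em_cj_lin E.
have a0 := cj_alr_gt0 oj (ltnW ru).
have b0 := cj_alr_gt0 oj ru.
have A0 : 0 < em (alr j r) := lt_le_trans (em_al_gt0 j) (em_alr_ge j r).
have B0 : 0 < em (alr j r.+1) := lt_le_trans (em_al_gt0 j) (em_alr_ge j _).
have nA := norm_ge1 (alr_inL j r) A0 a0.
have nB := norm_ge1 (alr_inL j r.+1) B0 b0.
have H r0 : (r0 <= u j.+1)%N -> em x = em (alr j r0) -> exists2 j, ~~ odd j & x = al j.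
  move=> hr /(emb_inj) ex.
  have := @alr_norm_gt1 j r0 oj; rewrite -ex nx ltxx => hh.
  have /orP[/eqP r00|/eqP r0u] : (r0 == 0)%N || (r0 == u j.+1).
    by move: hh hr; case: ltngtP => //; lia.
    exists j => //; apply: emb_inj.
    by rewrite ex em_alr r00 mul0r addr0.
  exists j.+2; rewrite /= ?negbK //; apply: emb_inj.
  by rewrite ex r0u em_alr_u.
move: nx; rewrite E E' => nx.
have ef1 : (e * e + f * f <= 1)%N.
  rewrite -(ler_nat R) natrD !natrM -[leRHS]/1 -[leRHS]nx.
  have he := ler0n R e; have hf := ler0n R f.
  have hAb := mulr_gt0 A0 b0; have hBa := mulr_gt0 B0 a0.
  set X := em (alr j r) in nA hAb *; set Y := em (alr j r.+1) in nB hBa *.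
  move: nA nB hAb hBa; move: (cj (alr j r)) (cj (alr j r.+1)) => x' y' k1 k2 k3 k4.
  rewrite -subr_ge0 [X in 0 <= X](_ : _ = e%:R * e%:R * (X * x' - 1) +
    f%:R * f%:R * (Y * y' - 1) + e%:R * f%:R * (X * y' + Y * x')); last by ring.
  have k5 : 0 <= X * y' + Y * x' by rewrite addr_ge0 // ltW.
  by rewrite !addr_ge0 // !mulr_ge0 // subr_ge0.
have [[e1 f0]|[[e0 f1]|[e0 f0]]] : (e = 1 /\ f = 0)%N \/ (e = 0 /\ f = 1)%N \/ (e = 0 /\ f = 0)%N.
- by case: e f ef1 {E E' nx} => [|[|e]] [|[|f]] //= _; auto.
- by apply: (H r (ltnW ru)); rewrite E e1 f0; ring.
- by apply: (H r.+1 ru); rewrite E e0 f1; ring.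
by move: nx; rewrite e0 f0 !mul0r addr0 mul0r => /eqP; rewrite eq_sym oner_eq0.
Qed.

(* The difference [z] of the two sides satisfies [z * (al j)' = m] with [m] a
   rational integer, because both sides span the same area with [al j]; and
   [-1 < m < 1] because the conjugates of both sides lie in [(- (al j)', 0)]. *)
Lemma unit_al_mul j : ~~ odd j -> em (al j) * cj (al j) = 1 ->
  al j.+1 = mul (al j) (al 1).
Proof.
move=> oj nj; apply: (cj_inj); rewrite cjM.
have W := wronskian j; rewrite -signr_odd (negbTE oj) mul1r in W.
pose z := addK (mul (al j) (al 1)) (mul (intK (-1)) (al j.+1)).
have zL : inL (mul z (conjK (al j))).
  apply: inL_mul => //; last by apply: inL_conj => //; exact: al_inL.
  apply: inL_add => //; first by apply: inL_mul => //; exact: al_inL.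
  by apply: inL_mul => //; [exact: inL_Z | exact: al_inL].
have ez : em z = em (al j) * em (al 1) - em (al j.+1).
  by rewrite embD !embM embZ mulN1r.
have cz : cj z = cj (al j) * cj (al 1) - cj (al j.+1).
  by rewrite cjD !cjM cjZ mulN1r.
have [m [n hv]] := zL.
have ev : em (mul z (conjK (al j))) = em z * cj (al j) by rewrite embM.
have cv : cj (mul z (conjK (al j))) = cj z * em (al j) by rewrite cjM conjKK.
have eqv : em z * cj (al j) = cj z * em (al j).
  rewrite ez cz em_al1 cj_al1; apply/eqP; rewrite -subr_eq0; apply/eqP.
  transitivity (em (al j) * cj (al j) * (em om - cj om) -
    (em (al j.+1) * cj (al j) - em (al j) * cj (al j.+1))); first by ring.
  by rewrite nj W; ring.
have n0 : n = 0.
  move: ev cv; rewrite hv lat_emb lat_cj eqv => <- /eqP.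
  rewrite eq_sym -subr_eq0 opprD addrACA subrr add0r -mulrBr mulf_eq0 intr_eq0.
  by rewrite (gt_eqF om_sub_gt0) orbF => /eqP.
have mE : cj z * em (al j) = m%:~R by rewrite -cv hv lat_cj n0 mul0r addr0.
have j0 := em_al_gt0 j; have c0 := cj_al_even oj.
have d1 := cj_al_odd (j := 1) isT.
have dj := cj_al_odd (j := j.+1) oj.
have x1 := xi_gt1 1; have xj := xi_gt1 j.+1.
have e1 := xiS 0; have ej := xiS j.
rewrite cj_al0 in e1.
have b1 : -1 < cj (al 1) by nra.
have bj : - cj (al j) < cj (al j.+1) by nra.
have l1 : -1 < m%:~R :> R by rewrite -mE cz; nra.
have l2 : m%:~R < 1 :> R by rewrite -mE cz; nra.
have m0 : m = 0.
  by move: l1 l2; rewrite -[1]/(1%:~R) -rmorphN /= !ltr_int; lia.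
move: mE; rewrite m0 => /eqP; rewrite mulf_eq0 (gt_eqF j0) orbF cz subr_eq0.
by move/eqP.
Qed.

(** An even period, so that the unit [al (tper s)] has norm 1 and not -1. *)
Definition tper (s : nat) := if odd s then s.*2 else s.

Lemma tper_even s : ~~ odd (tper s).
Proof. by rewrite /tper; case: (boolP (odd s)); rewrite ?odd_double. Qed.

Lemma tper_period s : u_period s -> u_period (tper s).
Proof.
by rewrite /tper => h; case: odd => // i hi; rewrite -addnn addnA !h // addn_gt0 hi.
Qed.

(** Minimality of eps gives eps <= [al (tper s)]. Conversely eps is [al j] with j even, and
    [unit_al_mul] makes j a period; j < [tper s] would contradict the minimality of s. *)
Lemma eps_al s eps : min_period R D s -> tp_fund_unit R D eps ->
  eps = al (tper s).
Proof.
move=> [s0 [sp smin]] [ue [te [e1 emin]]].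
have t0 : (0 < tper s)%N by rewrite /tper; case: odd; rewrite ?double_gt0.
have tp := tper_period sp; have te' := tper_even s.
have le1 : em eps <= em (al (tper s)).
  apply: emin; first exact: al_unit.
    by split; [apply: em_al_gt0 | apply: cj_al_even].
  by rewrite -(em_al0) (lt_le_trans (em_al_ltS 0)) // em_al_le.
have [j oj ej] := unit_is_al (inOK_L (proj1 ue)) (proj2 te) e1 (unit_norm ue te).
have jp : u_period j.
  by apply: period_of_xi; apply: xi_of_al_mul; apply: unit_al_mul; rewrite // -ej unit_norm.
have j0 : (0 < j)%N by case: j ej e1 {oj jp} => // -> ; rewrite em_al0 ltxx.
have [tj|jt] := leqP (tper s) j.
  apply: emb_inj; apply/le_anti; rewrite le1 /= ej.
  exact: em_al_le.
suff [k [k0 ks kp]] : exists k, [/\ (0 < k)%N, (k < s)%N & u_period k].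
  by have [|i [i1 []]] := smin k; rewrite ?k0 // kp.
have [js|sj] := ltnP j s; first by exists j.
move: jt; rewrite /tper; case: (boolP (odd s)) => os jt; last by move: jt; rewrite ltnNge sj.
(* Here s is odd and s <= j < 2s: j differs from s by parity, and j - s is a period shorter than
   s. *)
exists (j - s)%N; split.
- rewrite subn_gt0 ltn_neqAle sj andbT; apply/eqP => e.
  by move: oj; rewrite -e os.
- by move: jt; rewrite -addnn; lia.
move=> i i1; rewrite -(sp (i + (j - s))%N); last by rewrite addn_gt0 i1.
by rewrite -addnA subnK // jp.
Qed.

(** From [al (1 + s)] = [al s] times [al 1] and the recurrence, [al 1] - u_s is the ratio of two
    consecutive increasing [al], so it lies in (0, 1). Hence u_s is the floor of u_0 - omega' = u_0
    - [trO] + omega. *)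
Lemma u_last s : (0 < s)%N -> u_period s -> (u s)%:Z = (2 * u 0)%N%:Z - trO.
Proof.
case: s => // s _ sp.
have E : em (al s) = em (al s.+1) * (em (al 1) - (u s.+1)%:R).
  have := em_alSS s; rewrite -[s.+2]/(1 + s.+1)%N (al_shift 1 sp) embM => e.
  by rewrite mulrBr e; ring.
have h1 := em_al_gt0 s; have h2 := em_al_ltS s.
have g1 : 0 < em (al 1) - (u s.+1)%:R by nra.
have g2 : em (al 1) - (u s.+1)%:R < 1 by nra.
have htr := om_trace.
have f1 := floor_le (xi 0); have f2 := floorD1_gt (xi 0).
rewrite intrD -u_floor in f2; rewrite -u_floor // in f1.
rewrite em_al1 in g1 g2; rewrite -[xi 0]/(em om) in f1 f2.
have : `|((2 * u 0)%N%:Z - trO - (u s.+1)%:Z)%:~R| < 1 :> R.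
  have k1 : (2 * u 0)%N%:Z%:~R = 2 * (u 0)%:R :> R by rewrite -natrM.
  have k2 : (u s.+1)%:Z%:~R = (u s.+1)%:R :> R by [].
  rewrite !intrB k1 k2 -htr ltr_norml; lra.
rewrite -intr_norm -[1]/(1%:~R) ltr_int; lia.
Qed.

(** * The set S_0 and the quadratic form *)

Lemma al_eps_shift eps t k j : u_period t -> eps = al t ->
  em (al (j + k * t)) = em eps ^+ k * em (al j).
Proof.
move=> tp ->; elim: k => [|k IH]; first by rewrite addn0 mul1r.
by rewrite mulSn addnCA addnC al_shift // embM IH exprS mulrA.
Qed.

Lemma u_period_mul t k i : u_period t -> (0 < i)%N -> u (i + k * t) = u i.
Proof.
move=> tp i0; elim: k => [|k IH]; first by rewrite addn0.
by rewrite mulSn addnCA addnC tp // addn_gt0 i0.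
Qed.

Definition S0_seq (t : nat) : seq Kel :=
  [seq alr (2 * k) r | k <- iota 0 t./2, r <- iota 0 (u (2 * k).+1)].

Lemma size_S0_seq t : size (S0_seq t) = (\sum_(0 <= k < t./2) u (2 * k).+1)%N.
Proof.
rewrite size_allpairs_dep sumnE big_map /index_iota subn0.
by apply: eq_bigr => k _; rewrite size_iota.
Qed.

Lemma mem_S0_seq t x : ~~ odd t -> reflect
  (exists j r, [/\ ~~ odd j, (j < t)%N, (r < u j.+1)%N & x = alr j r])
  (x \in S0_seq t).
Proof.
move=> ot; have et : t = (2 * t./2)%N by rewrite mul2n -[LHS]odd_double_half (negbTE ot).
apply: (iffP allpairsPdep) => [[k [r []]]|[j [r [oj jt ru ->]]]].
  rewrite !mem_iota !add0n /= => kt ru ->; exists (2 * k)%N, r; split=> //.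
    by rewrite mul2n odd_double.
  by rewrite et ltn_mul2l.
have ej : j = (2 * j./2)%N by rewrite mul2n -[LHS]odd_double_half (negbTE oj).
exists j./2, r; rewrite !mem_iota !add0n /= -ej; split=> //.
by rewrite -(ltn_pmul2l (isT : 0 < 2)%N) -ej -et.
Qed.

(** The embeddings increase strictly in the lexicographic order of (j, r). *)
Lemma alr_inj j r j' r' : ~~ odd j -> ~~ odd j' -> (r < u j.+1)%N ->
  (r' < u j'.+1)%N -> em (alr j r) = em (alr j' r') -> j = j' /\ r = r'.
Proof.
move=> oj oj' ru ru' e.
have lt i k i' k' : ~~ odd i -> ~~ odd i' -> (k < u i.+1)%N -> (i < i')%N ->
    em (alr i k) < em (alr i' k').
  by move=> oi oi' ki ii'; apply: lt_le_trans (em_alr_ge _ _); apply: em_alr_lt_al.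
have jj : j = j'.
  case: (ltngtP j j') => // h; [have := lt _ _ _ r' oj oj' ru h | have := lt _ _ _ r oj' oj ru' h];
  by rewrite e ltxx.
split=> //; subst j'.
by case: (ltngtP r r') => // h; have := em_alr_lt j h; rewrite e ltxx.
Qed.

Lemma uniq_S0_seq t : uniq (S0_seq t).
Proof.
apply: allpairs_uniq_dep; [exact: iota_uniq | by move=> k _; exact: iota_uniq |].
move=> [k r] [k' r'] /allpairsPdep[? [? [_ h e]]] /allpairsPdep[? [? [_ h' e']]] /= E.
case: e h => <- <- h; case: e' h' => <- <- h'; rewrite !mem_iota /= !add0n in h h'.
have [] := alr_inj _ _ h h' (congr1 em E); rewrite ?mul2n ?odd_double //.
by move=> /double_inj -> ->.
Qed.

(** Being below [al t] means j < t. Since the conjugate of [alr j r] is at most 1 and [alr j r] at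
    least 1, the only conjugate lying below the diagonal is 1 = [alr 0 0]. *)
Lemma inS0_seq t x : ~~ odd t -> (0 < t)%N ->
  inS0 R D (al t) x <-> x \in S0_seq t.
Proof.
move=> ot t0; split.
  case=> [[j [r [oj [ru ex]]]]] [xlt [cle c0]]; apply/mem_S0_seq => //.
  case: ex => ex.
    exists j, r; split=> //; rewrite ltnNge; apply/negP => tj.
    have := em_al_le tj; have := em_alr_ge j r; rewrite -ex; lra.
  exists 0%N, 0%N; split=> //; first exact: u_gt0.
  apply: emb_inj; rewrite em_alr mul0r addr0 em_al0.
  move: cle; rewrite ex conjKK.
  have := cj_alr_le1 r oj; have := em_alr_ge j r; have := em_al_ge1 j; lra.
case/mem_S0_seq => // j [r [oj jt ru ->]]; split; last split; last split.
- by exists j, r; split=> //; split=> //; left.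
- exact: em_alr_lt_al.
- by have := cj_alr_le1 r oj; have := em_alr_ge j r; have := em_al_ge1 j; lra.
- by apply: cj_alr_gt0 => //; exact: ltnW.
Qed.

(** * The number of elements of S_0 *)

Lemma sum_odd_index (f : nat -> nat) m :
  (\sum_(0 <= k < m.+1) f (2 * k).+1 + \sum_(0 <= k < m) f (2 * k).+2 =
   \sum_(1 <= i < (2 * m).+2) f i)%N.
Proof.
elim: m => [|m IH]; first by rewrite big_nat1 big_geq // addn0 big_nat1.
rewrite mulnS !add2n [in RHS]big_nat_recr //= [in RHS]big_nat_recr //= -IH.
rewrite [X in (X + _)%N]big_nat_recr //= [X in (_ + X)%N]big_nat_recr //=.
by rewrite addnACA addnA addnAC mulnS add2n.
Qed.

(** The odd indices up to s stay in place; those between s and 2s are s plus the even numbers 2,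
    ..., s - 1. Together they cover one full period. *)
Lemma sum_odd_period s : odd s -> u_period s ->
  (\sum_(0 <= k < s) u (2 * k).+1 = \sum_(1 <= i < s) u i + u s)%N.
Proof.
move=> os sp; have es : s = (2 * s./2).+1 by rewrite mul2n -[LHS]odd_double_half os.
move: (s./2) es => m es; rewrite -big_nat_recr; last by rewrite es.
rewrite [in RHS]es -sum_odd_index (@big_cat_nat _ _ _ m.+1) //=; last by rewrite es; lia.
congr addn; rewrite -{1}[m.+1]add0n big_addn.
have -> : (s - m.+1 = m)%N by rewrite es; lia.
apply: eq_bigr => k _; rewrite -(sp (2 * k).+2) //; congr u; rewrite es; lia.
Qed.

(** For odd s the last term u_s, evaluated by [u_last], produces the 2 u_0 of [M_D], and the -1 when
    D is 1 modulo 4. *)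
Lemma size_S0_M s : (0 < s)%N -> u_period s -> size (S0_seq (tper s)) = M_D R D s.
Proof.
move=> s0 sp; rewrite size_S0_seq /tper /M_D; case: (boolP (odd s)) => os //=.
rewrite doubleK sum_odd_period // addnC.
have := u_last s0 sp; have := u_gt0 0; rewrite /trO.
by case: ifP => _; lia.
Qed.

(** * Representing totally positive integers *)

Lemma S0_rep t j r : ~~ odd t -> (0 < t)%N -> u_period t -> ~~ odd j ->
  (r < u j.+1)%N -> exists k, exists2 sg, sg \in S0_seq t &
    em (alr j r) = em (al t) ^+ k * em sg.
Proof.
move=> ot t0 tp oj ru.
have ej := divn_eq j t; rewrite addnC in ej.
have ou : u j.+1 = u (j %% t).+1 by rewrite {1}ej -addSn u_period_mul.
exists (j %/ t)%N, (alr (j %% t) r).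
  apply/mem_S0_seq => //; exists (j %% t)%N, r; split; rewrite -?ou ?ltn_mod //.
  by move: oj; rewrite {1}ej oddD oddM (negbTE ot) andbF addbF.
rewrite !em_alr {1 2}ej -addSn !(al_eps_shift (eps := al t)) //; ring.
Qed.

Lemma al_even_ge2 t : ~~ odd t -> (0 < t)%N -> 2 <= em (al t).
Proof.
case: t => [|[|t]] // ot _; apply: le_trans (em_al_le (isT : (2 <= t.+2)%N)).
have := em_al_ltS 0; rewrite em_alSS em_al0.
by have := u_gt0 1; rewrite -(ler_nat R); nra.
Qed.

Definition powK (x : Kel) (n : nat) : Kel := iter n (mul x) oneK.

Lemma em_powK x n : em (powK x n) = em x ^+ n.
Proof. by elim: n => [|n IH]; rewrite ?emb1 // embM IH exprS. Qed.

Lemma cj_powK x n : cj (powK x n) = cj x ^+ n.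
Proof. by elim: n => [|n IH]; rewrite ?cj1 // cjM IH exprS. Qed.

Lemma inL_powK x n : inL x -> inL (powK x n).
Proof. by move=> hx; elim: n => [|n IH]; [exact: (inL_Z 1) | exact: inL_mul]. Qed.

Lemma qform_add e L y1 y2 :
  (forall sg i, em (y1 sg i) * em (y2 sg i) = 0) ->
  qform R D e L (fun sg i => addK (y1 sg i) (y2 sg i)) =
  qform R D e L y1 + qform R D e L y2.
Proof.
move=> h; have sq sg i : em (addK (y1 sg i) (y2 sg i)) ^+ 2 =
    em (y1 sg i) ^+ 2 + em (y2 sg i) ^+ 2.
  by rewrite embD sqrrD h mul0rn addr0.
by rewrite /qform -big_split /=; apply: eq_bigr => sg _; rewrite !sq; ring.
Qed.

Lemma qform_scale e L c y :
  qform R D e L (fun sg i => mul c (y sg i)) = em c ^+ 2 * qform R D e L y.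
Proof.
rewrite /qform big_distrr /=; apply: eq_bigr => sg _; rewrite !embM; ring.
Qed.

(* [c * e ^+ k] for [c] a sum of four squares: [e ^+ k] is the square of
   [e ^+ k./2], times [e] when [k] is odd.  So an even [k] uses the variables
   0-3 of [tau] and an odd [k] its variables 4-7. *)
Definition slot (e : Kel) (a : nat -> int) (k : nat) (tau sg : Kel) (i : nat) : Kel :=
  if (sg == tau) && ((3 < i)%N == odd k)
  then mul (intK (a (i %% 4)%N)) (powK e k./2) else intK 0.

Lemma slot_inL e a k tau sg i : inL e -> inL (slot e a k tau sg i).
Proof.
move=> he; rewrite /slot; case: ifP => _; last exact: inL_Z.
by apply: inL_mul; [exact: inL_Z | exact: inL_powK].
Qed.

Lemma qform_slot e L a k tau : uniq L -> tau \in L ->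
  qform R D e L (slot e a k tau) =
  (a 0%N ^+ 2 + a 1%N ^+ 2 + a 2%N ^+ 2 + a 3%N ^+ 2)%:~R * (em e ^+ k * em tau).
Proof.
move=> uL tL; rewrite /qform (bigD1_seq tau) //= big1 ?addr0; last first.
  by move=> sg /negbTE ne; rewrite /slot ne /= !embZ; ring.
rewrite -{9}(odd_double_half k) exprD -muln2 exprM /slot eqxx /=.
by case: (odd k); rewrite /= !embM !embZ !em_powK !intrD !rmorphXn /=; ring.
Qed.

Lemma slot_disjoint e a b k l tau rho sg i : (tau = rho -> odd k != odd l) ->
  em (slot e a k tau sg i) * em (slot e b l rho sg i) = 0.
Proof.
rewrite /slot => h; case: (eqVneq sg tau) => [e1|_]; last by rewrite embZ mul0r.
case: (eqVneq sg rho) => [e2|_]; last by rewrite [em (intK 0)]embZ mulr0.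
have {h} := h (etrans (esym e1) e2).
by case: (3 < i)%N; case: (odd k); case: (odd l) => //= _; rewrite [em (intK 0)]embZ ?mul0r ?mulr0.
Qed.

Lemma em_nat_sum4sq (n : nat) : exists a : nat -> int,
  n%:R = (a 0%N ^+ 2 + a 1%N ^+ 2 + a 2%N ^+ 2 + a 3%N ^+ 2)%:~R :> R.
Proof.
have [a [b [c [d E]]]] := sum4sq_nat n.
by exists (nth 0 [:: a; b; c; d]); rewrite /= -E.
Qed.

(* The two generators of a cone are less than a factor [em e] apart, so if they
   are associated to the same element of S_0 the two powers of [e] have
   different parities and the two multiples use disjoint sets of variables. *)
Lemma cone_represented t j r (e f : nat) L : ~~ odd t -> (0 < t)%N ->
  u_period t -> ~~ odd j -> (r < u j.+1)%N -> uniq L -> L =i S0_seq t ->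
  exists2 y : Kel -> nat -> Kel, (forall sg i, inL (y sg i)) &
    e%:R * em (alr j r) + f%:R * em (alr j r.+1) = qform R D (al t) L y.
Proof.
move=> ot t0 tp oj ru uL eL.
have [k [tau tS etau]] := S0_rep ot t0 tp oj ru.
have [l [rho rS erho]] : exists k, exists2 sg, sg \in S0_seq t &
    em (alr j r.+1) = em (al t) ^+ k * em sg.
  (* At r + 1 = u_{j+1} the second generator is [al j.+2], which is [alr j.+2 0]. *)
  have [ru1|ru1] := ltnP r.+1 (u j.+1); first exact: S0_rep.
  have -> : r.+1 = u j.+1 by apply/eqP; rewrite eqn_leq ru ru1.
  rewrite em_alr_u; have o2 : ~~ odd j.+2 by rewrite /= negbK.
  have [k' [sg hs es]] := S0_rep ot t0 tp o2 (u_gt0 j.+3).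
  by exists k', sg => //; rewrite -es em_alr mul0r addr0.
have [a ea] := em_nat_sum4sq e; have [b eb] := em_nat_sum4sq f.
exists (fun sg i => addK (slot (al t) a k tau sg i) (slot (al t) b l rho sg i)).
  by move=> sg i; apply: inL_add; apply: slot_inL; apply: al_inL.
rewrite qform_add; last first.
  move=> sg i; apply: slot_disjoint => tr; subst rho.
  have E2 := al_even_ge2 ot t0.
  have lt1 : em (alr j r) < em (alr j r.+1) by apply: em_alr_lt.
  have le2 : em (alr j r.+1) <= em (al t) * em (alr j r).
    apply: le_trans (em_alr_le j ru) _; rewrite em_alr_u.
    apply: le_trans (em_al_le (_ : j.+2 <= j + 1 * t)%N) _.
      by rewrite mul1n -addn2 leq_add2l; case: (t) t0 ot => [|[]].
    rewrite (al_eps_shift _ _ tp erefl) expr1 ler_pM2l ?em_alr_ge //; lra.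
  have s0 : 0 < em tau.
    have := lt_le_trans (em_al_gt0 j) (em_alr_ge j r).
    by rewrite etau pmulr_rgt0 // exprn_gt0 //; lra.
  have E1 : 1 < em (al t) by lra.
  move: lt1 le2; rewrite etau erho mulrA -exprS ltr_pM2r // ler_pM2r //.
  rewrite ltr_eXn2l // ler_eXn2l // => k1 k2.
  have -> : l = k.+1 by apply/eqP; rewrite eqn_leq k1 k2.
  by rewrite /=; case: odd.
by rewrite !qform_slot ?eL // -ea -eb etau erho.
Qed.

Lemma universal_form_S0 s eps L : min_period R D s -> tp_fund_unit R D eps ->
  uniq L -> (forall sg, sg \in L <-> inS0 R D eps sg) ->
  universal_form R D eps L /\ size L = M_D R D s.
Proof.
move=> hs he uL hL; have [s0 [sp _]] := hs.
have ot := tper_even s; have tp := tper_period sp.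
have t0 : (0 < tper s)%N by rewrite /tper; case: odd; rewrite ?double_gt0.
have ee := eps_al hs he; have [ue [te _]] := he.
have eL : L =i S0_seq (tper s).
  move=> x; apply/idP/idP; first by move/hL; rewrite ee; apply: (proj1 (inS0_seq _ ot t0)).
  by move=> h; apply/hL; rewrite ee; apply/inS0_seq.
split; last first.
  by rewrite -size_S0_M //; apply/perm_size/uniq_perm => //; exact: uniq_S0_seq.
move=> a /(inOK_L) aL [a0 a0'].
have E2 : 2 <= em eps by rewrite ee al_even_ge2.
have nE := unit_norm ue te; have cE0 : 0 < cj eps := proj2 te.
(* N exceeds a' / a, and eps^N >= 2^N > N. *)
have [N hN] : exists N, cj a <= em a * em eps ^+ N.
  exists (Num.bound (cj a / em a)); rewrite -ler_pdivrMl // mulrC.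
  apply: le_trans (ltW (archi_boundP _)) _; first by rewrite ltW // divr_gt0.
  apply: le_trans (_ : 2 ^+ Num.bound (cj a / em a) <= _).
    by rewrite -natrX ler_nat ltnW // ltn_expl.
  by rewrite lerXn2r ?nnegrE //; lra.
have eL' : inL eps by rewrite ee; exact: al_inL.
(* The exponent is even so that the multiplication can be undone by scaling the variables. *)
pose b := mul a (powK eps N.*2).
have cE1 : cj eps <= 1 by nra.
have [|||j [r [e [f [oj ru eb]]]]] := cone (b := b).
- by apply: inL_mul => //; exact: inL_powK.
- by rewrite cjM cj_powK mulr_gt0 ?exprn_gt0.
- rewrite cjM cj_powK embM em_powK.
  apply: le_trans (_ : cj a <= _); first by rewrite ger_pMr // exprn_ile1 // ltW.
  apply: le_trans hN _; rewrite ler_pM2l // -addnn exprD.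
  by rewrite ler_peMr ?exprn_ge0 ?exprn_ege1 //; lra.
have [y yL ey] := cone_represented e f ot t0 tp oj ru uL eL.
(* The scaling factor enters the form squared, and eps'^(2N) cancels eps^(2N) because eps has norm
   1. *)
exists (fun sg i => mul (powK (conjK eps) N) (y sg i)); split.
  by move=> sg i; apply: inL_OK; apply: inL_mul => //; apply: inL_powK; apply: inL_conj.
rewrite qform_scale [in qform _ _ _ _ _]ee -ey -eb embM !em_powK.
rewrite mulrCA -exprM muln2 -exprMn_comm; last exact: mulrC.
by rewrite [X in X ^+ _]mulrC nE expr1n mulr1.
Qed.
End RealQuadratic.

Theorem theorem10 (R : realType) (D : nat) (hD1 : (1 < D)%N)
  (hDsq : squarefree D) (s : nat) (hs : min_period R D s)
  (eps : Kel) (heps : tp_fund_unit R D eps)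
  (L : seq Kel) (hLuniq : uniq L) (hL : forall sg, sg \in L <-> inS0 R D eps sg) :
  universal_form R D eps L /\ (8 * size L = 8 * M_D R D s)%N.
Proof.
by have [hU ->] := universal_form_S0 hD1 hDsq hs heps hLuniq hL.
Qed.
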